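(* Let $n\ge 1$ and let $X_1,\ldots,X_n$ be independent non-negative random variables with finite first moment. For each $i\in\{1,\ldots,n\}$ let $M_i=\mathbb{E}\left[\max(X_i^1,\ldots,X_i^n)\right]$, where $X_i^1,\ldots,X_i^n$ are independent random variables each having the same distribution as $X_i$. Put $X_{(n)}=\max(X_1,\ldots,X_n)$, $M_{(n)}=\max(M_1,\ldots,M_n)$ and $\bar M=\frac1n\sum_{i=1}^n M_i$. Then $$\bar M\leq\mathbb{E}[X_{(n)}]\leq\bar M+\frac{n-1}{n}M_{(n)}.$$ In particular, if $M_i=M$ for all $i=1,\ldots,n$, then $$M\leq\mathbb{E}[X_{(n)}]\leq\left(2-\frac1n\right)M.$$
   Context: The random variables $X_1,\ldots,X_n$ are not assumed to be identically distributed. *)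

(* Defs.v *)
From HB Require Import structures.
From mathcomp Require Import all_boot all_order all_algebra.
From mathcomp Require Import all_classical all_reals all_analysis.

Set Implicit Arguments.
Unset Strict Implicit.
Unset Printing Implicit Defensive.

Import Order.TTheory GRing.Theory Num.Theory.
Import numFieldNormedType.Exports.

Local Open Scope classical_set_scope.
Local Open Scope ring_scope.
Local Open Scope ereal_scope.

(* The seed of the iterated maximum is one of the x i, so that the result is
   the maximum of x_0, ..., x_(n-1) without any sign assumption. *)
Definition finmax (d : Order.disp_t) (T : orderType d) (n : nat)
    (hn : (0 < n)%N) (x : 'I_n -> T) : T :=
  \big[Order.max/x (Ordinal hn)]_(i < n) x i.

Definition mutually_independent (d : measure_display) (T : measurableType d)
    (R : realType) (P : probability T R) (I : finType)
    (X : I -> {RV P >-> R}) : Prop :=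
  forall (J : {set I}) (B : I -> set R),
    (forall i, i \in J -> measurable (B i)) ->
    P [set t | forall i, i \in J -> B i (X i t)] =
    \prod_(i in J) P (X i @^-1` B i).

(* The comparison is restricted to measurable sets because the values of a
   measure outside of them are unspecified. *)
Definition same_distribution (d d' : measure_display)
    (T : measurableType d) (T' : measurableType d') (R : realType)
    (P : probability T R) (P' : probability T' R)
    (X : {RV P >-> R}) (Y : {RV P' >-> R}) : Prop :=
  forall A : set R, measurable A -> distribution P X A = distribution P' Y A.

(* Main.v *)
Require Import Defs.
From HB Require Import structures.
From mathcomp Require Import all_boot all_order all_algebra.
From mathcomp Require Import all_classical all_reals all_analysis.
From mathcomp Require Import measurable_realfun ring lra.

Set Implicit Arguments.
Unset Strict Implicit.
Unset Printing Implicit Defensive.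

Import Order.TTheory GRing.Theory Num.Theory.
Import numFieldNormedType.Exports.

Local Open Scope classical_set_scope.
Local Open Scope ring_scope.
Local Open Scope ereal_scope.

(** Write F_i for the distribution function of X_i and a_i = F_i(r). By
    independence the maximum of the X_i has distribution function prod_i F_i,
    and the maximum of n copies of X_i has distribution function F_i^n, so the
    tail formula for expectations of non-negative variables gives

      E[X_(n)] = int_0^oo (1 - prod_i F_i)   and   M_i = int_0^oo (1 - F_i^n).

    The lower bound is the integral of the pointwise inequality between
    arithmetic and geometric means, prod_i a_i <= (1/n) sum_i a_i^n.

    The upper bound has no pointwise form, because the maximum over i is taken
    outside the integral; it uses that each F_i is nondecreasing. Put
    m = M_(n), b_i = F_i(m) and w_i = 1 / (1 + b_i + ... + b_i^(n-1)), which is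
    at least 1/n. The two inequalities

      r < m:   1 - prod_i a_i + sum_i (w_i - 1/n)
                 <= sum_i w_i (1 - a_i^n) + (n-1)/n      (as a_i <= b_i),
      r >= m:  1 - prod_i a_i <= sum_i w_i (1 - a_i^n)   (as a_i >= b_i)

    hold for all a_i in [0, 1]. Integrating them over [0, m[ and [m, oo[ gives

      E[X_(n)] + m sum_i (w_i - 1/n) <= sum_i w_i M_i + m (n-1)/n,

    and since M_i <= m, the right-hand side is at most
    (1/n) sum_i M_i + m sum_i (w_i - 1/n) + m (n-1)/n. The sum over the
    w_i - 1/n, which play the part of Lagrange multipliers for the constraints
    M_i <= m, then cancels.

    Both pointwise inequalities (one_sub_prod_le_below, one_sub_prod_le_above)
    rest on 1 - prod_i a_i <= sum_i (1 - a_i). Let v_i be the weight formed from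
    a_i in place of b_i; the weights decrease in their argument, so that
    w_i a_i^n <= v_i a_i^n <= a_i / n when a_i <= b_i, and
    w_i (1 - a_i^n) >= v_i (1 - a_i^n) = 1 - a_i when a_i >= b_i. *)

(** * Pointwise inequalities on the unit cube *)

Section PointwiseInequalities.
Local Open Scope ring_scope.
Variable F : realFieldType.

(** The inequality between arithmetic and geometric means for the a_i^n. *)
Lemma prod_le_mean_expn (n : nat) (a : 'I_n -> F) : (0 < n)%N ->
  (forall i, 0 <= a i) -> \prod_(i < n) a i <= n%:R^-1 * \sum_(i < n) a i ^+ n.
Proof.
move=> n_gt0 a_ge0.
have an_ge0 i : 0 <= a i ^+ n by rewrite exprn_ge0.
have [+ _] := @leif_AGM F _ [set: 'I_n]%SET (fun i => a i ^+ n)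
  (fun i _ => an_ge0 i).
rewrite cardsT card_ord.
under eq_bigl do rewrite finset.in_setT.
under [X in X / _]eq_bigl do rewrite finset.in_setT.
rewrite prodrXl mulrC ler_pXn2r// nnegrE; first by rewrite prodr_ge0.
by rewrite mulr_ge0 ?invr_ge0 ?ler0n ?sumr_ge0.
Qed.

(** The union bound for independent events of probability 1 - a i. *)
Lemma one_sub_prod_le_sum (n : nat) (a : 'I_n -> F) :
  (forall i, 0 <= a i <= 1) -> 1 - \prod_(i < n) a i <= \sum_(i < n) (1 - a i).
Proof.
move=> a01.
(* The product has to stay in [0, 1] for the induction to go through. *)
suff [] : 0 <= \prod_(i < n) a i <= 1 /\
    1 - \prod_(i < n) a i <= \sum_(i < n) (1 - a i) by [].
elim/big_ind2: _ => [|x1 x2 y1 y2 [] + + [] + +|i _].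
- lra.
- move=> /andP[? ?] ? /andP[? ?] ?; nra.
- have := a01 i; lra.
Qed.

(** The weight w_i of the proof idea above, as a function of b_i. For b <> 1
    it equals (1 - b) / (1 - b^n), the ratio of the tails of X_i and of the
    maximum of its n copies; the geometric sum keeps it meaningful at b = 1. *)
Definition invgeom (n : nat) (b : F) : F := (\sum_(k < n) b ^+ k)^-1.

Variable n : nat.
Hypothesis n_gt0 : (0 < n)%N.

Let geom_gt0 (b : F) : 0 <= b -> 0 < \sum_(k < n) b ^+ k.
Proof.
move=> b_ge0; case: n n_gt0 => // m _; rewrite big_ord_recl expr0.
by rewrite ltr_pwDl// sumr_ge0// => i _; rewrite exprn_ge0.
Qed.

Lemma invgeom_mul (b : F) : 0 <= b -> invgeom n b * (1 - b ^+ n) = 1 - b.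
Proof.
move=> b_ge0; rewrite -opprB subrX1 -mulNr opprB mulrCA mulVf ?mulr1//.
by rewrite gt_eqF ?geom_gt0.
Qed.

Lemma invgeom_antitone (a b : F) : 0 <= a -> a <= b ->
  invgeom n b <= invgeom n a.
Proof.
move=> a_ge0 ab; rewrite lef_pV2 ?posrE ?geom_gt0// ?(le_trans a_ge0)//.
by apply: ler_sum => i _; rewrite lerXn2r ?nnegrE// (le_trans a_ge0).
Qed.

Lemma invgeom_ge (b : F) : 0 <= b <= 1 -> n%:R^-1 <= invgeom n b.
Proof.
move=> /andP[b_ge0 b_le1].
rewrite lef_pV2 ?posrE ?geom_gt0 ?ltr0n//.
rewrite -[X in _ <= X%:R](card_ord n) -sumr_const.
by apply: ler_sum => i _; rewrite exprn_ile1.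
Qed.

(** Each of the n terms of the geometric sum is at least b^(n-1). *)
Lemma invgeom_mul_expn_le (b : F) :
  0 <= b <= 1 -> invgeom n b * b ^+ n <= b / n%:R.
Proof.
move=> /andP[b_ge0 b_le1]; rewrite mulrC ler_pdivrMr ?geom_gt0//.
rewrite mulrAC ler_pdivlMr ?ltr0n//.
rewrite -[X in _ ^+ X](prednK n_gt0) exprS -mulrA ler_wpM2l//.
rewrite -[X in _ * X%:R](card_ord n) mulr_natr -sumr_const.
apply: ler_sum => i _; rewrite ler_wiXn2l// -ltnS prednK//.
Qed.

Variables a b : 'I_n -> F.
Hypothesis a01 : forall i, 0 <= a i <= 1.
Hypothesis b01 : forall i, 0 <= b i <= 1.

(** As invgeom is antitone, w_i a_i^n <= a_i / n, so that it suffices to show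
    (sum_i a_i) / n <= prod_i a_i + (n-1)/n. With s = sum_i a_i - (n-1), this is
    s / n <= prod_i a_i, and it follows from s <= prod_i a_i and
    0 <= prod_i a_i. *)
Lemma one_sub_prod_le_below : (forall i, a i <= b i) ->
  1 - \prod_(i < n) a i + \sum_(i < n) (invgeom n (b i) - n%:R^-1) <=
  \sum_(i < n) invgeom n (b i) * (1 - a i ^+ n) + (n%:R - 1) / n%:R.
Proof.
move=> ab.
have n0 : n%:R != 0 :> F by rewrite pnatr_eq0 -lt0n.
have wa : \sum_(i < n) invgeom n (b i) * a i ^+ n <= (\sum_(i < n) a i) / n%:R.
  rewrite mulr_suml; apply: ler_sum => i _.
  apply: le_trans (invgeom_mul_expn_le (a01 i)).
  have /andP[a_ge0 _] := a01 i.
  by rewrite ler_wpM2r ?exprn_ge0// invgeom_antitone.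
have := one_sub_prod_le_sum a01.
rewrite !sumrB !sumr_const card_ord => h.
have p_ge0 : 0 <= \prod_(i < n) a i.
  by rewrite prodr_ge0// => i _; have /andP[] := a01 i.
under [in leRHS]eq_bigr do rewrite mulrBr mulr1.
rewrite sumrB -[n%:R^-1 *+ n]mulr_natr mulVf//.
have n1 : 1 <= n%:R :> F by rewrite ler1n.
have : (\sum_(i < n) a i) / n%:R <= \prod_(i < n) a i + (n%:R - 1) / n%:R.
  rewrite ler_pdivrMr ?ltr0n// mulrDl divfK//.
  move: h p_ge0 n1; set p := \prod_(i < n) _; set s := \sum_(i < n) a i.
  move=> h p0 n1.
  have pn : p <= p * n%:R by rewrite ler_peMr.
  lra.
lra.
Qed.

(** The weight at b_i is at least the weight at a_i, which turns 1 - a_i^n into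
    exactly 1 - a_i. *)
Lemma one_sub_prod_le_above : (forall i, b i <= a i) ->
  1 - \prod_(i < n) a i <= \sum_(i < n) invgeom n (b i) * (1 - a i ^+ n).
Proof.
move=> ba; apply: le_trans (one_sub_prod_le_sum a01) _.
apply: ler_sum => i _.
have /andP[a_ge0 a_le1] := a01 i; have /andP[b_ge0 _] := b01 i.
rewrite -invgeom_mul// ler_wpM2r ?subr_ge0 ?exprn_ile1//.
exact: invgeom_antitone.
Qed.

End PointwiseInequalities.

(** * Integrated inequalities for distribution functions *)

Section IntegratedInequalities.
Variables (R : realType) (n : nat) (F : 'I_n -> R -> R).
Hypothesis n_gt0 : (0 < n)%N.
Hypothesis F_nd : forall i, {homo F i : x y / (x <= y)%R}.
Hypothesis F01 : forall i x, (0 <= F i x <= 1)%R.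

Local Notation mu := (@lebesgue_measure R).
Local Notation D := (`[0%R, +oo[%classic : set R).
Local Notation M i := (\int[mu]_(x in D) (1 - F i x ^+ n)%:E).
Local Notation EX := (\int[mu]_(x in D) (1 - \prod_(i < n) F i x)%:E).

Let integralD_EFin (f g : R -> R) :
  (forall x, (0 <= f x)%R) -> (forall x, (0 <= g x)%R) ->
  measurable_fun D f -> measurable_fun D g ->
  \int[mu]_(x in D) (f x)%:E + \int[mu]_(x in D) (g x)%:E =
  \int[mu]_(x in D) (f x + g x)%:E.
Proof.
move=> f_ge0 g_ge0 mf mg; under [RHS]eq_integral do rewrite EFinD.
rewrite ge0_integralD//.
- by move=> x _; rewrite lee_fin.
- exact/measurable_EFinP.
- by move=> x _; rewrite lee_fin.
- exact/measurable_EFinP.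
Qed.

Let le_integral_EFin (f g : R -> R) : (forall x, (0 <= f x)%R) ->
  measurable_fun D f -> measurable_fun D g ->
  (forall x, (0 <= x)%R -> (f x <= g x)%R) ->
  \int[mu]_(x in D) (f x)%:E <= \int[mu]_(x in D) (g x)%:E.
Proof.
move=> f_ge0 mf mg fg; apply: ge0_le_integral => //.
- by move=> x _; rewrite lee_fin.
- exact/measurable_EFinP.
- exact/measurable_EFinP.
- by move=> x /=; rewrite in_itv/= andbT lee_fin; exact: fg.
Qed.

Let mF i : measurable_fun D (F i).
Proof. by apply: measurable_funTS; apply: nondecreasing_measurable. Qed.

Let mtail i : measurable_fun D (fun x => 1 - F i x ^+ n)%R.
Proof. by apply: measurable_funB => //; apply: measurable_funX. Qed.

Let emtail i : measurable_fun D (fun x => (1 - F i x ^+ n)%:E).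
Proof. by apply/measurable_EFinP; exact: mtail. Qed.

Let tail_ge0 i x : 0 <= (1 - F i x ^+ n)%:E.
Proof. by case/andP: (F01 i x) => ? ?; rewrite lee_fin subr_ge0 exprn_ile1. Qed.

Let mprod : measurable_fun D (fun x => 1 - \prod_(i < n) F i x)%R.
Proof.
by apply: measurable_funB => //; apply: measurable_prod => i _; exact: mF.
Qed.

Let prod_ge0 x : (0 <= 1 - \prod_(i < n) F i x)%R.
Proof. by rewrite subr_ge0 prodr_ile1. Qed.

Let integral_weighted_sum (c : 'I_n -> R) : (forall i, (0 <= c i)%R) ->
  \int[mu]_(x in D) (\sum_(i < n) c i * (1 - F i x ^+ n))%:E =
  \sum_(i < n) (c i)%:E * M i.
Proof.
move=> c_ge0; under eq_integral do rewrite -sumEFin.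
rewrite ge0_integral_sum//.
- apply: eq_bigr => i _; under eq_integral do rewrite EFinM.
  by rewrite ge0_integralZl_EFin//; exact: emtail.
- move=> i; apply/measurable_EFinP; apply: measurable_funM => //.
  exact: mtail.
- by move=> i x _; rewrite EFinM mule_ge0// lee_fin.
Qed.

Lemma mean_tail_expn_le : (n%:R^-1)%:E * \sum_(i < n) M i <= EX.
Proof.
rewrite ge0_sume_distrr; last by move=> i _; exact: integral_ge0.
rewrite -(@integral_weighted_sum (fun=> n%:R^-1)%R)//.
apply: le_integral_EFin => //.
- by move=> x; rewrite sumr_ge0// => i _; rewrite mulr_ge0// -lee_fin.
- by apply: measurable_sum => i; apply: measurable_funM => //; exact: mtail.
- move=> x _; rewrite -mulr_sumr sumrB mulrBr sumr_const card_ord.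
  rewrite mulVf ?pnatr_eq0 -?lt0n// lerB// prod_le_mean_expn// => i.
  by case/andP: (F01 i x).
Qed.

(** Transfers finiteness from E[X_i] to M_i. *)
Lemma tail_expn_le_linear i : M i <= n%:R%:E * \int[mu]_(x in D) (1 - F i x)%:E.
Proof.
rewrite -ge0_integralZl_EFin//.
- apply: ge0_le_integral => //.
  + exact: emtail.
  + apply: measurable_funeM; apply/measurable_EFinP.
    by apply: measurable_funB => //; exact: mF.
  + move=> x _; rewrite -EFinM lee_fin.
    (* Bernoulli's inequality, as the case of n equal factors. *)
    have := @one_sub_prod_le_sum R n (fun=> F i x) (fun=> F01 i x).
    by rewrite prodr_const sumr_const card_ord mulr_natl.
- by move=> x _; case/andP: (F01 i x) => ? ?; rewrite lee_fin subr_ge0.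
- by apply/measurable_EFinP; apply: measurable_funB => //; exact: mF.
Qed.

(** The two regimes r < m and r >= m are joined into one inequality on [0, oo[
    with the help of the indicator of [0, m[, whose integral is m. All terms are
    kept non-negative by moving sum_i (w_i - 1/n) to the left-hand side. *)
Lemma tail_prod_le_mean_add (m : R) : (0 <= m)%R -> (forall i, M i <= m%:E) ->
  EX <= (n%:R^-1)%:E * \sum_(i < n) M i + ((n%:R - 1) / n%:R * m)%:E.
Proof.
move=> m_ge0 Mm.
pose w i := invgeom n (F i m).
have w_ge i : (n%:R^-1 <= w i)%R by exact: invgeom_ge.
have w_ge0 i : (0 <= w i)%R by apply: le_trans (w_ge i).
pose L := (\sum_(i < n) (w i - n%:R^-1))%R.
have L_ge0 : (0 <= L)%R by rewrite sumr_ge0// => i _; rewrite subr_ge0.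
have K_ge0 : (0 <= (n%:R - 1) / n%:R :> R)%R.
  by rewrite divr_ge0// subr_ge0 ler1n.
have mI : measurable_fun D (\1_(`[0%R, m[%classic) : R -> R) by [].
have int_indic (c : R) : (0 <= c)%R ->
    \int[mu]_(x in D) (c * \1_(`[0%R, m[%classic) x)%:E = (c * m)%:E.
  move=> c_ge0; under eq_integral do rewrite EFinM.
  rewrite ge0_integralZl_EFin//; last by apply/measurable_EFinP.
  rewrite integral_indic// setIidl; last first.
    by move=> x /=; rewrite !in_itv/= andbT => /andP[].
  rewrite /= lebesgue_measure_itv/= lte_fin -EFinD subr0.
  by case: ltgtP m_ge0 => // <-; rewrite !mulr0 mule0.
have mW : measurable_fun D (fun x => (\sum_(i < n) w i * (1 - F i x ^+ n))%R).
  by apply: measurable_sum => i; apply: measurable_funM => //; exact: mtail.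
have W_ge0 x : (0 <= \sum_(i < n) w i * (1 - F i x ^+ n))%R.
  by rewrite sumr_ge0// => i _; rewrite mulr_ge0// -lee_fin.
have mc (c : R) : measurable_fun D (fun x => c * \1_(`[0%R, m[%classic) x)%R.
  exact: measurable_funM.
have c_ge0 (c x : R) : (0 <= c)%R -> (0 <= c * \1_(`[0%R, m[%classic) x :> R)%R.
  by move=> ?; rewrite mulr_ge0.
have weighted : EX + (L * m)%:E <=
    \sum_(i < n) (w i)%:E * M i + ((n%:R - 1) / n%:R * m)%:E.
  rewrite -integral_weighted_sum// -int_indic// -int_indic//.
  rewrite !integralD_EFin//.
  - apply: le_integral_EFin.
    + by move=> x; rewrite addr_ge0// c_ge0.
    + by apply: measurable_funD => //; exact: mprod.
    + exact: measurable_funD.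
    + move=> x x_ge0; rewrite indicE.
      have [xm|mx] := ltP x m.
        rewrite mem_set/=; last by rewrite in_itv/= x_ge0.
        by rewrite !mulr1; apply: one_sub_prod_le_below => // i; apply/F_nd/ltW.
      rewrite memNset/=; last by rewrite in_itv/= x_ge0 ltNge mx.
      rewrite !mulr0 !addr0.
      by apply: one_sub_prod_le_above => // i; exact: F_nd.
  - by move=> x; exact: c_ge0.
  - by move=> x; exact: c_ge0.
have Mbar_le : \sum_(i < n) (w i)%:E * M i <=
    (n%:R^-1)%:E * \sum_(i < n) M i + (L * m)%:E.
  rewrite ge0_sume_distrr; last by move=> i _; exact: integral_ge0.
  rewrite /L mulr_suml -sumEFin -big_split/=; apply: lee_sum => i _.
  rewrite -[X in X%:E * _](subrK n%:R^-1%R) EFinD.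
  rewrite ge0_muleDl ?lee_fin ?subr_ge0// addeC leeD2l// EFinM.
  by rewrite lee_wpmul2l// lee_fin subr_ge0.
have := le_trans weighted (leeD2r _ Mbar_le).
by rewrite [X in _ <= X -> _]addeAC leeD2rE.
Qed.

End IntegratedInequalities.

(** * Maxima of finite families *)

Lemma finmax_le (n : nat) (hn : (0 < n)%N) (d : Order.disp_t)
  (U : orderType d) (x : 'I_n -> U) (r : U) :
  reflect (forall i, (x i <= r)%O) (finmax hn x <= r)%O.
Proof.
apply: (iffP (bigmax_leP _ _ _ _)) => [[_ xr] i|xr]; first exact: xr.
by split=> [|i _]; exact: xr.
Qed.

Lemma le_finmax (n : nat) (hn : (0 < n)%N) (d : Order.disp_t)
  (U : orderType d) (x : 'I_n -> U) i : (x i <= finmax hn x)%O.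
Proof. by have /finmax_le := lexx (finmax hn x); exact. Qed.

Lemma finmax_const (n : nat) (hn : (0 < n)%N) (d : Order.disp_t)
  (U : orderType d) (x : 'I_n -> U) (u : U) : (forall i, x i = u) ->
  finmax hn x = u.
Proof.
move=> xu; apply/le_anti/andP; split; first by apply/finmax_le => i; rewrite xu.
by rewrite -[leLHS](xu (Ordinal hn)); exact: le_finmax.
Qed.

(** * Expectation of a maximum of independent variables *)

Section TailFormula.
Context (d : measure_display) (T : measurableType d) (R : realType)
  (P : probability T R).

(** The tail formula when non-negativity only holds almost everywhere: passing
    to the positive part changes neither the expectation nor the tails above a
    non-negative level. *)
Lemma expectation_tail (f : {RV P >-> R}) :
  {ae P, forall t, (0 <= f t)%R} ->
  'E_P[f] = \int[@lebesgue_measure R]_(r in `[0%R, +oo[) ccdf f r.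
Proof.
move=> f_ge0; transitivity 'E_P[f^\+%R].
  rewrite unlock; apply: ae_eq_integral => //.
  - exact/measurable_EFinP.
  - exact/measurable_EFinP.
  - by apply: filterS f_ge0 => t ft _; rewrite /= /funrpos max_l.
rewrite ge0_expectation_ccdf; last first.
  by move=> t; rewrite /funrpos le_max lexx orbT.
apply: eq_integral => r; rewrite inE/= in_itv/= andbT => r_ge0.
rewrite /ccdf /distribution /pushforward; congr (P _).
apply/seteqP; split=> t /=; rewrite !in_itv/= !andbT /funrpos lt_max ltNge.
  by case/orP => //; rewrite ltNge r_ge0.
by move=> ->.
Qed.

Lemma measurable_finmax (n : nat) (hn : (0 < n)%N) (X : 'I_n -> {RV P >-> R}) :
  measurable_fun setT (fun t => finmax hn (fun i => X i t)).
Proof.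
rewrite /finmax; elim: (index_enum _) => [|i s IH].
  by under eq_fun do rewrite big_nil; exact: measurable_funPT.
under eq_fun do rewrite big_cons.
by apply: measurable_maxr; [exact: measurable_funPT|].
Qed.

Lemma expectation_finmax (n : nat) (hn : (0 < n)%N) (X : 'I_n -> {RV P >-> R}) :
  mutually_independent X -> (forall i, {ae P, forall t, (0 <= X i t)%R}) ->
  'E_P[fun t => finmax hn (fun i => X i t)] =
  \int[@lebesgue_measure R]_(r in `[0%R, +oo[)
    (1 - \prod_(i < n) fine (cdf (X i) r))%:E.
Proof.
move=> X_indep X_ge0.
pose Y : {RV P >-> R} := HB.pack (fun t => finmax hn (fun i => X i t))
  (isMeasurableFun.Build _ _ _ _ _ (measurable_finmax hn X)).
rewrite (expectation_tail (f := Y)); last first.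
  apply: filterS (X_ge0 (Ordinal hn)) => t X_ge.
  exact: le_trans X_ge (le_finmax _ _ _).
apply: eq_integral => r _; rewrite ccdf_1_cdf EFinB; congr (_ - _).
transitivity
  (P [set t | forall i, i \in [set: 'I_n]%SET -> `]-oo, r]%classic (X i t)]).
  rewrite /cdf /distribution /pushforward; congr (P _).
  apply/seteqP; split=> t /=; rewrite in_itv/=.
    by move=> /finmax_le Xr i _; rewrite in_itv/=.
  move=> Xr; apply/finmax_le => i.
  by have := Xr i (finset.in_setT i); rewrite in_itv.
rewrite (X_indep _ (fun=> `]-oo, r]%classic))//.
rewrite -prodEFin; under eq_bigl do rewrite finset.in_setT.
by apply: eq_bigr => i _; rewrite fineK// fin_num_measure.
Qed.

End TailFormula.

(** * The bounds *)

Lemma same_distribution_ae_ge0 (d d' : measure_display) (T : measurableType d)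
    (T' : measurableType d') (R : realType) (P : probability T R)
    (P' : probability T' R) (f : {RV P >-> R}) (g : {RV P' >-> R}) :
  same_distribution f g -> {ae P, forall t, (0 <= f t)%R} ->
  {ae P', forall t, (0 <= g t)%R}.
Proof.
move=> fg [N [mN N0 fN]]; exists (g @^-1` `]-oo, 0%R[); split.
- by rewrite -[_ @^-1` _]setTI; exact: measurable_funP.
- have -> : P' (g @^-1` `]-oo, 0%R[) = P (f @^-1` `]-oo, 0%R[).
    by have /esym := fg `]-oo, 0%R[%classic (measurable_itv _).
  apply: (subset_measure0 _ mN _ N0).
    by rewrite -[_ @^-1` _]setTI; exact: measurable_funP.
  by move=> t /=; rewrite in_itv/= => ft; apply: fN; rewrite /= leNgt ft.
- by move=> t /= /negP; rewrite -ltNge in_itv.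
Qed.

Theorem theorem1 (R : realType) (n : nat) (hn : (0 < n)%N)
    (d : measure_display) (T : measurableType d) (P : probability T R)
    (X : 'I_n -> {RV P >-> R})
    (X_indep : mutually_independent X)
    (X_ge0 : forall i, {ae P, forall t, (0 <= X i t)%R})
    (X_int : forall i, P.-integrable setT (EFin \o X i))
    (dc : 'I_n -> measure_display)
    (Tc : forall i : 'I_n, measurableType (dc i))
    (Pc : forall i : 'I_n, probability (Tc i) R)
    (Xc : forall i : 'I_n, 'I_n -> {RV (Pc i) >-> R})
    (Xc_indep : forall i, mutually_independent (Xc i))
    (Xc_dist : forall i j, same_distribution (X i) (Xc i j)) :
  let M : 'I_n -> \bar R :=
    fun i => 'E_(Pc i)[fun t => finmax hn (fun j => Xc i j t)] in
  let EX : \bar R := 'E_P[fun t => finmax hn (fun i => X i t)] in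
  let Mmax : \bar R := finmax hn M in
  let Mbar : \bar R := (n%:R^-1)%:E * \sum_(i < n) M i in
  (Mbar <= EX /\ EX <= Mbar + ((n%:R - 1) / n%:R)%:E * Mmax) /\
  (forall m : \bar R, (forall i, M i = m) ->
     m <= EX /\ EX <= (2 - n%:R^-1)%:E * m).
Proof.
move=> M EX Mmax Mbar.
pose F i r := fine (cdf (X i) r).
have F01 i r : (0 <= F i r <= 1)%R.
  by rewrite fine_ge0//= -lee_fin fineK ?cdf_le1 ?fin_num_measure.
have F_nd i : {homo F i : x y / (x <= y)%R}.
  by move=> x y xy; rewrite fine_le ?fin_num_measure// cdf_nondecreasing.
have EX_F : EX = \int[@lebesgue_measure R]_(r in `[0%R, +oo[)
    (1 - \prod_(i < n) F i r)%:E by exact: expectation_finmax.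
have M_F i : M i = \int[@lebesgue_measure R]_(r in `[0%R, +oo[)
    (1 - F i r ^+ n)%:E.
  rewrite /M expectation_finmax//; last first.
    by move=> j; exact: same_distribution_ae_ge0 (X_ge0 i).
  apply: eq_integral => r _; rewrite (eq_bigr (fun=> F i r)).
    by rewrite prodr_const card_ord.
  by move=> j _; rewrite /F /cdf (Xc_dist i j).
have M_ge0 i : 0 <= M i.
  rewrite M_F; apply: integral_ge0 => r _; have /andP[F0 F1] := F01 i r.
  by rewrite lee_fin subr_ge0 exprn_ile1.
have M_fin i : M i \is a fin_num.
  rewrite ge0_fin_numE// M_F.
  apply: le_lt_trans (tail_expn_le_linear F_nd F01 i) _.
  apply: lte_mul_pinfty => //.
  have -> : \int[@lebesgue_measure R]_(r in `[0%R, +oo[) (1 - F i r)%:E =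
      'E_P[X i].
    rewrite expectation_tail//; apply: eq_integral => r _.
    by rewrite ccdf_1_cdf EFinB fineK ?fin_num_measure.
  by rewrite unlock; exact: integral_fune_lt_pinfty (X_int i).
have M_le i : M i <= Mmax by exact: le_finmax.
have Mmax_fin : Mmax \is a fin_num.
  rewrite /Mmax /finmax; elim/big_ind: _ => // x y ? ?.
  by rewrite maxEle; case: ifP.
have Mmax_ge0 : 0 <= Mmax := le_trans (M_ge0 (Ordinal hn)) (M_le _).
have lower : Mbar <= EX.
  rewrite EX_F /Mbar (eq_bigr _ (fun i _ => M_F i)).
  exact: mean_tail_expn_le.
have upper : EX <= Mbar + ((n%:R - 1) / n%:R)%:E * Mmax.
  rewrite EX_F /Mbar -(fineK Mmax_fin) -EFinM (eq_bigr _ (fun i _ => M_F i)).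
  apply: tail_prod_le_mean_add => //; first exact: fine_ge0.
  by move=> i; rewrite -M_F fineK.
split=> // m Mm.
have Mbar_m : Mbar = m.
  have m_fin : m \is a fin_num by rewrite -(Mm (Ordinal hn)).
  rewrite /Mbar (eq_bigr _ (fun i _ => Mm i)) -(fineK m_fin) sumEFin -EFinM.
  rewrite sumr_const card_ord -[(fine m *+ n)%R]mulr_natl.
  by rewrite mulKf// pnatr_eq0 -lt0n.
have Mmax_m : Mmax = m by exact: finmax_const.
split; first by rewrite -Mbar_m.
apply: le_trans upper _; rewrite Mbar_m Mmax_m -[X in X + _]mul1e -ge0_muleDl//.
- rewrite -EFinD le_eqVlt; apply/orP; left; apply/eqP; congr (_%:E * _).
  by field; rewrite pnatr_eq0 -lt0n.
- by rewrite lee_fin divr_ge0// subr_ge0 ler1n.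
Qed.
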